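(* Let $x,y\in X$ satisfy $1<\partial(x,y)<k$ and write $i=\partial(x,y)$. Then $$\widehat{x\cap y}=\frac{[k-i][n-k-1]}{q^{k-1}[n-2k]}\,\widehat{x}+\frac{[k-i]}{q^{k-i+1}[i-1][n-2k]}\,\widehat{y}+\frac{-1}{q^{k+i}[n-2k]}\,B_{xy}+\frac{-[k-i]}{q^k[i-1][n-2k]}\,C_{xy},$$ $$\widehat{x+y}=\frac{-[k-1][n-k-i]}{q^{k-i-1}[n-2k]}\,\widehat{x}+\frac{-[n-k-i]}{q^{k-2i+1}[i-1][n-2k]}\,\widehat{y}+\frac{1}{q^k[n-2k]}\,B_{xy}+\frac{[n-k-i]}{q^{k-i}[i-1][n-2k]}\,C_{xy}.$$
   Context: Let $\mathbb{F}_q$ be a finite field with $q$ elements, let $n,k$ be integers with $n>2k\geq 6$, and let $V$ be an $n$-dimensional vector space over $\mathbb{F}_q$. For $m\in\mathbb{Z}$ write $[m]=(q^m-1)/(q-1)$. Let $P$ be the set of all subspaces of $V$ and $P_\ell$ the set of $\ell$-dimensional subspaces; put $X=P_k$. The Grassmann graph $\Gamma=J_q(n,k)$ has vertex set $X$, with $x,y\in X$ adjacent iff $\dim(x\cap y)=k-1$; $\partial$ is its path-length distance and $\Gamma(x)$ is the set of neighbours of $x$. Let $E$ be a (real) Euclidean space of dimension $[n]-1$ with inner product $\langle\,,\,\rangle$, and let $P_1\to E$, $s\mapsto\widehat{s}$ be a map such that: $E=\mathrm{Span}\{\widehat{s}\mid s\in P_1\}$; $\|\widehat{s}\|^2=[n]-1$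 for $s\in P_1$; $\langle\widehat{s},\widehat{t}\rangle=-1$ for distinct $s,t\in P_1$; and $\sum_{s\in P_1}\widehat{s}=0$. For $u\in P$ define $\widehat{u}=\sum_{s\in P_1,\,s\subseteq u}\widehat{s}$. For $x,y\in X$ with $1<\partial(x,y)<k$ define $\mathcal{B}_{xy}=\{z\in\Gamma(x)\mid\partial(y,z)=\partial(x,y)+1\}$, $\mathcal{C}_{xy}=\{z\in\Gamma(x)\mid\partial(y,z)=\partial(x,y)-1\}$, and $B_{xy}=\sum_{z\in\mathcal{B}_{xy}}\widehat{z}$, $C_{xy}=\sum_{z\in\mathcal{C}_{xy}}\widehat{z}$. *)

(* Defs.v *)
From HB Require Import structures.
From mathcomp Require Export all_boot all_order all_algebra.
From mathcomp Require Export reals.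
From mathcomp Require Export sesquilinear.

Set Implicit Arguments.
Unset Strict Implicit.
Unset Printing Implicit Defensive.

Import Order.TTheory GRing.Theory Num.Theory.
(* Needed only to see {vspace V} as a subtype of a matrix type. *)
Import VectorInternalTheory.
Local Open Scope ring_scope.

HB.instance Definition _ (F : finFieldType) (V : vectType F) :=
  [Finite of {vspace V} by <:].

Record grass (F : finFieldType) (V : vectType F) (l : nat) : Type :=
  Grass { grass_val :> {vspace V}; _ : \dim grass_val == l }.

HB.instance Definition _ (F : finFieldType) (V : vectType F) (l : nat) :=
  [isSub for @grass_val F V l].
HB.instance Definition _ (F : finFieldType) (V : vectType F) (l : nat) :=
  [Finite of grass V l by <:].

(* The least length of an e-path from x to y. In a graph on #|T| vertices any
   distance is less than #|T|; the junk value #|T| means that y is not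
   reachable from x. *)
Definition gdist (T : finType) (e : rel T) (x y : T) : nat :=
  find (fun m => [exists p : m.-tuple T, path e x p && (last x p == y)])
       (iota 0 #|T|).

Section Grassmann.
Variables (F : finFieldType) (V : vectType F) (k : nat).
Implicit Types x y : grass V k.

Definition grass_adj : rel (grass V k) :=
  fun x y => (\dim (x :&: y)%VS).+1 == k.

Definition grass_dist x y : nat := gdist grass_adj x y.

Definition grass_nbrs x : {set grass V k} := [set z | grass_adj x z].

Definition calB x y : {set grass V k} :=
  [set z in grass_nbrs x | grass_dist y z == (grass_dist x y).+1].

Definition calC x y : {set grass V k} :=
  [set z in grass_nbrs x | (grass_dist y z).+1 == grass_dist x y].

Variables (E : zmodType) (h : grass V 1 -> E).

Definition hat (u : {vspace V}) : E :=
  \sum_(s : grass V 1 | (s <= u)%VS) h s.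

Definition sumB x y : E := \sum_(z in calB x y) hat z.
Definition sumC x y : E := \sum_(z in calC x y) hat z.

End Grassmann.

Definition qnum (R : fieldType) (q : R) (m : int) : R := (q ^ m - 1) / (q - 1).

(* Main.v *)
Require Import Defs.
From mathcomp Require Import ssrAC finfield zify ring.
Set Implicit Arguments.
Unset Strict Implicit.
Unset Printing Implicit Defensive.
Import Order.TTheory GRing.Theory Num.Theory.
Local Open Scope ring_scope.

(** Write i = dist (x, y), so that dim (x :&: y) = k - i (grass_distE).  A
    neighbour z of x is determined by the hyperplane H = x :&: z of x together
    with a choice of z in the pencil of k-spaces through H.  Sorting neighbours
    by H describes both sets explicitly:

    - z is in C_xy iff H contains x :&: y and H <= z <= H + y (fiberC);
    - z is in B_xy iff H does not contain x :&: y and H <= z is not contained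
      in x + y (fiberB).

    The vector hat u is additive over points, so the sum of hat over a family
    of subspaces is governed by the number of members through each point.  Two
    such sums suffice: over a pencil of subspaces U < z <= W with
    dim z = dim U + 1 (sum_pencil), and over the hyperplanes of W through U
    (sum_hyperplane).  Summing first over the pencil, then over H, and using
    that the hat of the whole space vanishes, gives with P = x :&: y, M = x + y

      C_xy = [i-1] M^ + q^(i-1) y^ + q [i-1] ([i-1] x^ + q^(i-1) P^),
      B_xy = q^(i+1) [n-k-i] (q^(i-1) [k-i] x^ - q^(i-1) P^) - q^i [k-i] M^

    (sumCE and sumBE).  These are two linear equations in P^ and M^, whose
    determinant is, up to sign, a power of q times [i-1] [n-2k], because
    [n-k-i] - [k-i] = q^(k-i) [n-2k].  It is nonzero as 1 < i and 2k < n, and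
    solving the system yields the two formulas. *)

(** * Gaussian integers *)

(** The Gaussian integer [m] at Q, as a natural number because it counts
    subspaces. *)
Definition gnum (Q m : nat) : nat := (\sum_(j < m) Q ^ j)%N.

Lemma gnumS Q m : gnum Q m.+1 = (gnum Q m + Q ^ m)%N.
Proof. by rewrite /gnum big_ord_recr. Qed.

Lemma gnum0 Q : gnum Q 0 = 0%N.
Proof. by rewrite /gnum big_ord0. Qed.

Lemma gnum1 Q : gnum Q 1 = 1%N.
Proof. by rewrite gnumS gnum0. Qed.

Lemma gnumD Q m p : gnum Q (m + p) = (gnum Q m + Q ^ m * gnum Q p)%N.
Proof.
elim: p => [|p IH]; first by rewrite gnum0 muln0 !addn0.
by rewrite addnS !gnumS IH mulnDr addnA expnD.
Qed.

Lemma gnumSl Q m : gnum Q m.+1 = (Q * gnum Q m).+1.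
Proof. by rewrite -add1n gnumD gnum1. Qed.

Lemma mul_gnum Q m : (0 < Q)%N -> (Q.-1 * gnum Q m = (Q ^ m).-1)%N.
Proof.
move=> Q0; elim: m => [|m IH]; first by rewrite gnum0 muln0.
rewrite gnumS mulnDr IH expnS; have := expn_gt0 Q m; rewrite Q0 /=; nia.
Qed.

Lemma double_count (S T : finType) (A : pred S) (B : pred T)
    (r : S -> T -> bool) m p :
  (forall a, A a -> #|[pred b | B b && r a b]| = m) ->
  (forall b, B b -> #|[pred a | A a && r a b]| = p) ->
  (#|A| * m = #|B| * p)%N.
Proof.
move=> hA hB; rewrite -!sum_nat_const.
transitivity (\sum_(a | A a) \sum_(b | B b && r a b) 1)%N.
  by apply: eq_bigr => a Aa; rewrite sum1_card hA.
rewrite (exchange_big_dep B) /=; last by move=> a b _ /andP[].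
apply: eq_bigr => b Bb; rewrite -(hB b Bb) -sum1_card.
by apply: eq_bigl => a; rewrite inE Bb.
Qed.

Lemma card_vectors (F : finFieldType) (V : vectType F) (U : {vspace V}) :
  #|[pred v : finvect_type V | (v : V) \in U]| = (#|F| ^ \dim U)%N.
Proof.
(* Exposing the structure of V makes the one carried by finvect_type V
   convertible to it. *)
case: V U => T c U.
by rewrite -(@card_vspace F (finvect_type (Vector.Pack c)) c U); apply: eq_card.
Qed.

Section Subspaces.
Variables (F : finFieldType) (V : vectType F).
Implicit Types (U W H K : {vspace V}).
Local Notation Q := #|F|.

Lemma dim_grass l (z : grass V l) : \dim z = l.
Proof. by case: z => z /= /eqP. Qed.

Lemma vline_dim (v : V) : v != 0 -> \dim <[v]>%VS == 1%N.
Proof. by rewrite dim_vline => ->. Qed.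

Lemma subv_dim_eq U W : (U <= W)%VS -> (\dim W <= \dim U)%N -> U = W.
Proof. by move=> UW dWU; apply/eqP; rewrite eqEdim UW. Qed.

(** * Points, pencils and hyperplanes *)

Lemma card_nzvectors U :
  #|[pred v : finvect_type V | ((v : V) != 0) && ((v : V) \in U)]| = (Q ^ \dim U).-1.
Proof.
rewrite -card_vectors [in RHS](cardD1 (0 : finvect_type V)) inE mem0v /=.
by apply: eq_card => v; rewrite !inE.
Qed.

(** Each point of U carries Q - 1 nonzero vectors, and each nonzero vector of
    U spans one point. *)
Lemma card_points U : #|[pred s : grass V 1 | (s <= U)%VS]| = gnum Q (\dim U).
Proof.
have Q1 : (1 < Q)%N := finNzRing_gt1 F.
apply/eqP; rewrite -(eqn_pmul2l (m := Q.-1)); last by lia.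
rewrite mul_gnum; last by lia.
rewrite -card_nzvectors mulnC -[X in _ == X]muln1; apply/eqP.
pose on_point (s : grass V 1) (v : finvect_type V) :=
  (v : V) \in (s : {vspace V}).
apply: (double_count (r := on_point)) => [s sU | v /andP[v0 vU]].
  have := card_nzvectors s; rewrite dim_grass expn1 => <-; apply: eq_card => v.
  rewrite !inE /on_point; case: (boolP (_ \in (s : {vspace V}))) => [vs|].
    by rewrite (subvP sU v vs) !andbT.
  by rewrite !andbF.
rewrite (eq_card1 (x := Grass (vline_dim v0))) // => s; rewrite !inE /on_point.
apply/andP/eqP => [[_ vs]|->]; last by rewrite memv_line; split=> //; apply: vU.
by apply/esym/val_inj/subv_dim_eq => //=; rewrite ?dim_grass ?dim_vline ?v0.
Qed.

Lemma card_points_diff U W : (U <= W)%VS ->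
  #|[pred s : grass V 1 | (s <= W)%VS && ~~ (s <= U)%VS]| =
    (Q ^ \dim U * gnum Q (\dim W - \dim U))%N.
Proof.
move=> UW.
have : (#|[pred s : grass V 1 | (s <= U)%VS]| +
  #|[pred s : grass V 1 | (s <= W)%VS && ~~ (s <= U)%VS]| =
  #|[pred s : grass V 1 | (s <= W)%VS]|)%N.
  rewrite -[in RHS](cardID [pred s : grass V 1 | (s <= U)%VS]).
  congr (_ + _)%N; apply: eq_card => s; rewrite !inE; last by rewrite andbC.
  by case: (boolP (s <= U)%VS) => [/subv_trans->|]; rewrite ?andbF.
rewrite !card_points -{1}(subnKC (dimvS UW)) gnumD => /eqP.
by rewrite eqn_add2l => /eqP.
Qed.

Lemma card_points_diff_in U W K : (U <= K)%VS -> (K <= W)%VS ->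
  #|[pred s : grass V 1 | ((s <= W)%VS && ~~ (s <= U)%VS) && (s <= K)%VS]| =
    (Q ^ \dim U * gnum Q (\dim K - \dim U))%N.
Proof.
move=> UK KW; rewrite -card_points_diff //; apply: eq_card => s.
rewrite !inE andbC; case: (boolP (s <= K)%VS) => //= sK.
by rewrite (subv_trans sK).
Qed.

Lemma dim_add_point U (s : grass V 1) :
  ~~ (s <= U)%VS -> \dim (U + s)%VS = (\dim U).+1.
Proof.
move=> sU; have := dimv_sum_cap U s; rewrite dim_grass.
case: (posnP (\dim (U :&: s))) => [->|d0]; first by lia.
suff: (s <= U)%VS by rewrite (negPf sU).
suff <- : (U :&: s)%VS = s by apply: capvSl.
by apply: subv_dim_eq; rewrite ?capvSr ?dim_grass.
Qed.

Lemma pencil_unique l U (z : grass V l) (s : grass V 1) : (\dim U).+1 = l ->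
  (U <= z)%VS -> (s <= z)%VS -> ~~ (s <= U)%VS -> (U + s)%VS = z.
Proof.
move=> dU Uz sz sU; apply: subv_dim_eq; first by rewrite subv_add Uz.
by rewrite dim_grass dim_add_point ?dU.
Qed.

Lemma card_pencil_through l U W (s : grass V 1) :
    (\dim U).+1 = l -> (U <= W)%VS -> (s <= W)%VS -> ~~ (s <= U)%VS ->
  #|[pred z : grass V l | ((U <= z)%VS && (z <= W)%VS) && (s <= z)%VS]| = 1%N.
Proof.
move=> dU UW sW sU.
have dz : \dim (U + s) == l by rewrite dim_add_point ?dU.
rewrite (eq_card1 (x := Grass dz)) // => z; rewrite !inE.
apply/andP/eqP => [[/andP[Uz zW] sz]|->/=].
  by apply/val_inj/esym/pencil_unique.
by rewrite addvSl addvSr subv_add UW.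
Qed.

(** Each point of W outside U lies in one member of the pencil, and each member
    has Q ^ dim U points outside U. *)
Lemma card_pencil l U W : (\dim U).+1 = l -> (U <= W)%VS ->
  #|[pred z : grass V l | (U <= z)%VS && (z <= W)%VS]| = gnum Q (\dim W - \dim U).
Proof.
move=> dU UW; have Q1 : (1 < Q)%N := finNzRing_gt1 F.
apply/eqP; rewrite -(eqn_pmul2l (m := (Q ^ \dim U)%N)); last first.
  by rewrite expn_gt0; lia.
rewrite -card_points_diff // mulnC -[X in _ == X]muln1; apply/eqP.
apply: (double_count (r := fun (z : grass V l) (s : grass V 1) => (s <= z)%VS)).
  move=> z /andP[Uz zW].
  by rewrite card_points_diff_in // dim_grass -dU subSnn gnum1 muln1.
by move=> s /andP[sW sU]; apply: card_pencil_through.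
Qed.

Definition hyperplane U W H :=
  [&& (U <= H)%VS, (H <= W)%VS & (\dim H).+1 == \dim W].

Lemma hyperplane_addl U W H K :
  hyperplane U W H && (K <= H)%VS = hyperplane (U + K) W H.
Proof.
by rewrite /hyperplane subv_add andbC; case: (K <= H)%VS; rewrite ?andbT ?andbF.
Qed.

Lemma hyperplane_cap x y H :
  hyperplane (x :&: y) x H -> (H :&: y)%VS = (x :&: y)%VS.
Proof.
case/and3P=> UH Hx _; apply/eqP.
by rewrite eqEsubv capvS //= subv_cap UH capvSr.
Qed.

(** Induction on the codimension of U in W, counting the flags s <= H where H is
    a hyperplane of W through U and s a point of H outside U: the hyperplanes
    through U and s are those through U + s, of smaller codimension. *)
Lemma card_hyperplane U W : (U <= W)%VS ->
  #|[pred H | hyperplane U W H]| = gnum Q (\dim W - \dim U).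
Proof.
move: {2}(\dim W - \dim U)%N (erefl (\dim W - \dim U)%N) => m.
elim: m U => [|m IH] U dm UW.
  have UWe : U = W by apply: subv_dim_eq => //; lia.
  rewrite -UWe subnn gnum0; apply: eq_card0 => H; rewrite !inE.
  by apply/negP => /and3P[/dimvS ? _ /eqP]; lia.
have Q1 : (1 < Q)%N := finNzRing_gt1 F; case: m IH dm => [|m] IH dm.
  rewrite dm gnum1 (eq_card1 (x := U)) // => H; rewrite !inE.
  apply/and3P/eqP => [[UH _ /eqP dH]|->]; last by rewrite subvv UW; split=> //; lia.
  by apply/esym/subv_dim_eq => //; lia.
apply/eqP; rewrite -(eqn_pmul2r (m := (Q ^ \dim U * gnum Q m.+1)%N)); last first.
  by rewrite gnumS muln_gt0 addn_gt0 !expn_gt0; lia.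
pose outside := [pred s : grass V 1 | (s <= W)%VS && ~~ (s <= U)%VS].
apply/eqP; transitivity (#|outside| * gnum Q m.+1)%N; last first.
  by rewrite card_points_diff // dm; ring.
apply: (double_count (r := fun H (s : grass V 1) => (s <= H)%VS)).
  move=> H /and3P[UH HW /eqP dH].
  by rewrite card_points_diff_in //; congr (_ * gnum _ _)%N; lia.
move=> s /andP[sW sU].
have dUs := dim_add_point sU.
transitivity #|[pred H | hyperplane (U + s) W H]|.
  by apply: eq_card => H; rewrite !inE hyperplane_addl.
have dm' : (\dim W - \dim (U + s))%N = m.+1 by lia.
by rewrite IH // ?subv_add ?UW ?dm'.
Qed.

(** * Sums of hat over pencils and hyperplanes *)

Section Hat.
Variables (E : zmodType) (h : grass V 1 -> E).
Local Notation hat := (hat h).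

Lemma sum_hat (T : finType) (P : pred T) (f : T -> {vspace V}) :
  \sum_(t | P t) hat (f t) =
    \sum_(s : grass V 1) h s *+ #|[pred t | P t && (s <= f t)%VS]|.
Proof.
rewrite (exchange_big_dep predT) //=; apply: eq_bigr => s _.
by rewrite sumr_const.
Qed.

Lemma hatE U : hat U = \sum_(s : grass V 1) h s *+ (s <= U)%VS.
Proof.
by rewrite /Defs.hat big_mkcond; apply: eq_bigr => s _; case: (s <= U)%VS.
Qed.

Lemma hat0 : hat 0%VS = 0.
Proof.
rewrite /Defs.hat big1 // => s; rewrite subv0 => /eqP s0.
by have := dim_grass s; rewrite s0 dimv0.
Qed.

(** A point of W outside U lies in one member of the pencil, a point of U in all
    of them; the excess is [m + 1] - 1 = Q [m], where m = dim W - l. *)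
Lemma sum_pencil l U W : (\dim U).+1 = l -> (U <= W)%VS -> (l <= \dim W)%N ->
  \sum_(z : grass V l | (U <= z)%VS && (z <= W)%VS) hat z =
    hat W + hat U *+ (Q * gnum Q (\dim W - l)).
Proof.
move=> dU UW lW; rewrite sum_hat !hatE -sumrMnl -big_split; apply: eq_bigr => s _ /=.
rewrite -mulrnA -mulrnDr; congr (_ *+ _).
case: (boolP (s <= W)%VS) => sW; last first.
  have /negPf-> : ~~ (s <= U)%VS by apply: contra sW => /subv_trans->.
  rewrite mul0n; apply: eq_card0 => z; rewrite !inE.
  apply/negP => /andP[/andP[_ zW] sz].
  by rewrite (subv_trans sz) in sW.
case: (boolP (s <= U)%VS) => sU /=.
  rewrite mul1n add1n -gnumSl.
  have -> : (\dim W - l).+1 = (\dim W - \dim U)%N by lia.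
  rewrite -(card_pencil dU UW); apply: eq_card => z; rewrite !inE.
  by case: (boolP (U <= z)%VS) => //= Uz; rewrite (subv_trans sU) ?andbT.
by rewrite mul0n addn0 card_pencil_through.
Qed.

(** Among the hyperplanes of W through U, a point of U lies in all [m + 1] and
    any other point s of W in the [m] ones through U + s; and
    [m + 1] - [m] = Q ^ m. *)
Lemma sum_hyperplane U W m : (U <= W)%VS -> \dim W = (\dim U + m).+1 ->
  \sum_(H | hyperplane U W H) hat H = hat W *+ gnum Q m + hat U *+ Q ^ m.
Proof.
move=> UW dW; rewrite sum_hat !hatE -!sumrMnl -big_split; apply: eq_bigr => s _ /=.
rewrite -!mulrnA -mulrnDr; congr (_ *+ _).
case: (boolP (s <= W)%VS) => sW; last first.
  have /negPf-> : ~~ (s <= U)%VS by apply: contra sW => /subv_trans->.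
  rewrite !mul0n; apply: eq_card0 => H; rewrite !inE.
  apply/negP => /andP[/and3P[_ HW _] sH].
  by rewrite (subv_trans sH) in sW.
have -> : #|[pred H | hyperplane U W H && (s <= H)%VS]| =
    #|[pred H | hyperplane (U + s) W H]|.
  by apply: eq_card => H; rewrite !inE hyperplane_addl.
rewrite card_hyperplane ?subv_add ?UW //.
case: (boolP (s <= U)%VS) => sU; rewrite !mul1n ?mul0n.
  by rewrite (addv_idPl sU) dW subSn ?leq_addr // addKn gnumS.
by rewrite dim_add_point // dW subSS addKn addn0.
Qed.

Lemma sum_hyperplane_const U W (c : E) : (U <= W)%VS ->
  \sum_(H | hyperplane U W H) c = c *+ gnum Q (\dim W - \dim U).
Proof.
by move=> UW; rewrite -card_hyperplane // -sumr_const; apply: eq_bigl.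
Qed.

(** By modularity, H |-> H + y is a bijection from the hyperplanes of x through
    x :&: y to the hyperplanes of x + y through y, with inverse K |-> K :&: x. *)
Lemma sum_hyperplane_add x y m : \dim (x + y)%VS = (\dim y + m).+1 ->
  \sum_(H | hyperplane (x :&: y) x H) hat (H + y)%VS =
    hat (x + y)%VS *+ gnum Q m + hat y *+ Q ^ m.
Proof.
move=> d; rewrite -sum_hyperplane ?addvSr //.
have dxy := dimv_sum_cap x y.
rewrite [RHS](reindex_onto (fun H => H + y)%VS (fun K => K :&: x)%VS) /=.
  apply: eq_bigl => H; apply/idP/andP.
    move=> hH; have [UH Hx /eqP dH] := and3P hH.
    have e : ((H + y) :&: x)%VS = H.
      by rewrite -vspace_modl // capvC (addv_idPl UH).
    split; last by rewrite e.
    rewrite /hyperplane addvSr addvS //=; apply/eqP.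
    by have := dimv_sum_cap H y; rewrite (hyperplane_cap hH); lia.
  case=> /and3P[_ Hs /eqP dH] /eqP e.
  rewrite /hyperplane -{1 2}e capvSr subv_cap capvSl /=.
  rewrite (subv_trans (capvSr _ _) (addvSr _ _)) /=.
  apply/eqP; have := dimv_sum_cap (H + y) x; rewrite e.
  have -> : (H + y + x = x + y)%VS; last by lia.
  by rewrite -addvA [(y + x)%VS]addvC (addv_idPr _) // (subv_trans (addvSl H y)).
move=> K /and3P[yK Kxy _].
by rewrite vspace_modr // (capv_idPl Kxy).
Qed.
End Hat.
End Subspaces.

(** * Distance in the Grassmann graph *)

(** A shortest path visits distinct vertices, so its length is below the number
    of vertices and falls in the range that gdist searches. *)
Lemma gdist_eq (T : finType) (e : rel T) (x y : T) p :
    path e x p -> last x p = y ->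
    (forall p', path e x p' -> last x p' = y -> (size p <= size p')%N) ->
  gdist e x y = size p.
Proof.
move=> ep lp min; rewrite /gdist; set P := (P in find P _).
have PP m : reflect (exists2 p', path e x p' & last x p' = y /\ size p' = m) (P m).
  apply: (iffP existsP) => [[t /andP[et /eqP lt]]|[p' ep' [lp' <-]]].
    by exists t; rewrite // size_tuple.
  by exists (in_tuple p'); rewrite ep' lp' eqxx.
have lt_p : (size p < #|T|)%N.
  move: (min); rewrite -lp; case/shortenP: ep => p' ep' up' _ min'.
  apply: leq_ltn_trans (min' p' ep' erefl) _.
  by have := max_card (mem (x :: p')); rewrite (card_uniqP up').
have Pp : P (size p) by apply/PP; exists p.
have hasP : has P (iota 0 #|T|) by apply/hasP; exists (size p); rewrite ?mem_iota.
case: (ltngtP (find P (iota 0 #|T|)) (size p)) => // lt.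
  have := nth_find 0%N hasP; rewrite nth_iota ?add0n; last exact: ltn_trans lt lt_p.
  by case/PP=> p' ep' [lp' sp']; have := min p' ep' lp'; rewrite sp' leqNgt lt.
by have := before_find 0%N lt; rewrite nth_iota ?add0n ?Pp.
Qed.

Section Grassmann.
Variables (F : finFieldType) (V : vectType F) (k : nat).
Implicit Types (x y z : grass V k) (H : {vspace V}).
Local Notation Q := #|F|.

(** One step changes the dimension of the intersection with y by at most one,
    since x :&: y and x :&: z meet inside z :&: y and x :&: z has codimension
    one in x. *)
Lemma adj_cap x z y : grass_adj x z -> (\dim (x :&: y) <= (\dim (z :&: y)).+1)%N.
Proof.
move/eqP=> a; have := dimv_sum_cap (x :&: y) (x :&: z).
have : (\dim (x :&: y + x :&: z) <= \dim x)%N.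
  by apply/dimvS; rewrite subv_add !capvSl.
have : (\dim (x :&: y :&: (x :&: z)) <= \dim (z :&: y))%N.
  apply/dimvS; rewrite subv_cap (subv_trans (capvSr _ _) (capvSr _ _)).
  exact: subv_trans (capvSl _ _) (capvSr _ _).
rewrite dim_grass; lia.
Qed.

Lemma adj_sym x z : grass_adj x z = grass_adj z x.
Proof. by rewrite /grass_adj capvC. Qed.

Lemma path_cap x p : path (@grass_adj F V k) x p ->
  (k <= \dim (x :&: last x p)%VS + size p)%N.
Proof.
elim: p x => [|z p IH] x /=; first by rewrite capvv dim_grass addn0.
case/andP; rewrite adj_sym => /(adj_cap (last z p)) + /IH; lia.
Qed.

Lemma cap_le x y : (\dim (x :&: y) <= k)%N.
Proof. by have := dimvS (capvSl x y); rewrite dim_grass. Qed.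

(** The neighbour is H + s, with H a hyperplane of x through x :&: y and s a
    point of y outside x. *)
Lemma closer_neighbour x y : (\dim (x :&: y) < k)%N ->
  exists2 z, grass_adj x z & \dim (z :&: y)%VS = (\dim (x :&: y)).+1.
Proof.
move=> lt.
have /card_gt0P[H] : (0 < #|[pred H | hyperplane (x :&: y) x H]|)%N.
  rewrite card_hyperplane ?capvSl // dim_grass -(subnSK lt) gnumSl; lia.
rewrite inE => /and3P[UH Hx]; rewrite dim_grass => /eqP dH.
have /card_gt0P[s] :
    (0 < #|[pred s : grass V 1 | (s <= y)%VS && ~~ (s <= x :&: y)%VS]|)%N.
  rewrite card_points_diff ?capvSr // dim_grass -(subnSK lt) gnumSl muln_gt0 expn_gt0.
  by have : (1 < Q)%N := finNzRing_gt1 F; lia.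
rewrite inE => /andP[sy]; rewrite subv_cap sy andbT => sx.
have sH : ~~ (s <= H)%VS by apply: contra sx => /subv_trans->.
have dz : \dim (H + s)%VS == k by rewrite dim_add_point ?dH.
have adj : grass_adj x (Grass dz).
  have nx : ~~ (Grass dz <= x)%VS by rewrite subv_add negb_and sx orbT.
  have HH : (H <= x :&: (Grass dz))%VS by rewrite subv_cap Hx addvSl.
  rewrite /grass_adj; apply/eqP; have := dimvS HH.
  have := cap_le x (Grass dz); rewrite leq_eqVlt => /orP[/eqP e|]; last by lia.
  case/negP: nx; have <- : (x :&: Grass dz)%VS = Grass dz; last exact: capvSl.
  by apply: subv_dim_eq; rewrite ?capvSr ?e ?dim_grass.
exists (Grass dz) => //; apply/eqP; rewrite eqn_leq.
rewrite adj_sym in adj; rewrite (adj_cap _ adj) /=.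
have sxy : ~~ (s <= x :&: y)%VS by rewrite subv_cap negb_and sx.
rewrite -(dim_add_point sxy) dimvS // subv_add !subv_cap capvSr addvSr sy !andbT.
exact: subv_trans UH (addvSl _ _).
Qed.

Lemma short_path x y d : (k = \dim (x :&: y) + d)%N ->
  exists2 p, path (@grass_adj F V k) x p & last x p = y /\ size p = d.
Proof.
elim: d x => [|d IH] x e.
  exists [::] => //; split=> //; apply/val_inj => /=.
  have c : (x :&: y)%VS = x.
    by apply: subv_dim_eq; rewrite ?capvSl ?dim_grass; lia.
  by apply: subv_dim_eq; rewrite -1?c ?capvSr ?dim_grass //; lia.
have [|z adj dz] := @closer_neighbour x y; first lia.
have [|p ep [lp sp]] := IH z; first lia.
by exists (z :: p); rewrite /= ?adj ?sp.
Qed.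

Lemma grass_distE x y : grass_dist x y = (k - \dim (x :&: y))%N.
Proof.
have [|p ep [lp sp]] := @short_path x y (k - \dim (x :&: y))%N.
  by rewrite subnKC ?cap_le.
rewrite -sp; apply: gdist_eq => // p' /path_cap + lp'.
by rewrite lp' sp leq_subLR.
Qed.

Lemma calBE x y z : (z \in calB x y) =
  grass_adj x z && ((\dim (y :&: z)).+1 == \dim (x :&: y)).
Proof.
rewrite !inE !grass_distE; congr andb.
have := cap_le y z; have := cap_le x y; lia.
Qed.

Lemma calCE x y z : (z \in calC x y) =
  grass_adj x z && (\dim (y :&: z) == (\dim (x :&: y)).+1).
Proof.
rewrite !inE !grass_distE; congr andb.
have := cap_le y z; have := cap_le x y; lia.
Qed.

(** * Neighbours of x sorted by their intersection with x *)

Lemma adj_hyperplane x z : grass_adj x z -> hyperplane 0%VS x (x :&: z).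
Proof. by rewrite /hyperplane sub0v capvSl dim_grass. Qed.

(** Here H :&: y = x :&: y, so z is one step closer to y exactly when y + z has
    the same dimension as its subspace H + y. *)
Lemma fiberC x y H z : hyperplane (x :&: y) x H ->
  (z \in calC x y) && ((x :&: z)%VS == H) = (H <= z)%VS && (z <= H + y)%VS.
Proof.
move=> hH; have [UH Hx] := and3P hH.
rewrite dim_grass calCE /grass_adj => /eqP dH.
have dHy := dimv_sum_cap H y; rewrite (hyperplane_cap hH) dim_grass in dHy.
have dyz := dimv_sum_cap y z; rewrite !dim_grass in dyz.
apply/andP/andP => [[/andP[/eqP a /eqP d] /eqP e]|[Hz zHy]].
  have Hz : (H <= z)%VS by rewrite -e capvSr.
  split=> //; have sub : (H + y <= y + z)%VS by rewrite addvC addvS.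
  by rewrite (subv_dim_eq sub) ?addvSr //; lia.
have e : (x :&: z)%VS = H.
  apply/eqP; rewrite eqEsubv subv_cap Hx Hz !andbT.
  apply: subv_trans (capvS (subvv x) zHy) _.
  by rewrite capvC -vspace_modl // capvC subv_add subvv.
have sE : (y + z)%VS = (H + y)%VS.
  apply/eqP; rewrite eqEsubv !subv_add addvSr zHy addvSl.
  by rewrite (subv_trans Hz) ?addvSr.
rewrite e eqxx; split=> //; rewrite dH eqxx /=; apply/eqP.
move: dyz; rewrite sE; lia.
Qed.

(** Inside z, the hyperplane x :&: z meets y :&: z in dimension at least
    dim (x :&: y), so it contains all of x :&: y. *)
Lemma fiberC_hyperplane x y z :
  z \in calC x y -> hyperplane (x :&: y) x (x :&: z).
Proof.
rewrite calCE /hyperplane capvSl dim_grass => /andP[adj /eqP d]; move/eqP in adj.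
rewrite adj eqxx /= andbT.
have s1 : (x :&: z + y :&: z <= z)%VS by rewrite subv_add !capvSr.
have := dimvS s1; have := dimv_sum_cap (x :&: z) (y :&: z); rewrite dim_grass.
set W := (_ :&: (y :&: z))%VS.
have sW : (W <= x :&: y)%VS.
  rewrite subv_cap (subv_trans (capvSl _ _) (capvSl _ _)).
  exact: subv_trans (capvSr _ _) (capvSl _ _).
move=> *; rewrite -(subv_dim_eq sW) ?capvSl //; lia.
Qed.

(** Here H + x :&: y = x, so any z through H satisfies x + y <= y + z; hence z
    is one step farther from y exactly when this inclusion is strict. *)
Lemma fiberB x y H z : hyperplane 0%VS x H -> ~~ (x :&: y <= H)%VS ->
  (z \in calB x y) && ((x :&: z)%VS == H) = (H <= z)%VS && ~~ (z <= x + y)%VS.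
Proof.
case/and3P=> _ Hx; rewrite dim_grass calBE /grass_adj => /eqP dH UH.
have Hxy : (H + x :&: y)%VS = x.
  apply: subv_dim_eq; rewrite ?subv_add ?Hx ?capvSl // dim_grass.
  apply: (@leq_trans (\dim H).+1); first by rewrite dH.
  rewrite ltnNge; apply: contra UH => le.
  rewrite [X in (_ <= X)%VS](subv_dim_eq (addvSl H (x :&: y)%VS) le).
  exact: addvSr.
have dyz := dimv_sum_cap y z; rewrite !dim_grass in dyz.
have dxy := dimv_sum_cap x y; rewrite !dim_grass in dxy.
have sub : (H <= z)%VS -> (x + y <= y + z)%VS.
  move=> Hz; rewrite subv_add addvSl -{1}Hxy subv_add (subv_trans Hz) ?addvSr //=.
  by rewrite (subv_trans (capvSr _ _)) ?addvSl.
apply/andP/andP => [[/andP[/eqP a /eqP d] /eqP e]|[Hz zN]].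
  have Hz : (H <= z)%VS by rewrite -e capvSr.
  split=> //; apply/negP => zxy.
  have : (y + z <= x + y)%VS by rewrite subv_add addvSr.
  by move/dimvS; lia.
have e : (x :&: z)%VS = H.
  apply/esym/subv_dim_eq; first by rewrite subv_cap Hx.
  have := cap_le x z; rewrite leq_eqVlt => /orP[/eqP c|]; last by lia.
  case/negP: zN; have <- : (x :&: z)%VS = z.
    by apply: subv_dim_eq; rewrite ?capvSr ?c ?dim_grass.
  by rewrite (subv_trans (capvSl _ _)) ?addvSl.
have adj : grass_adj x z by rewrite /grass_adj e dH.
rewrite e eqxx dH eqxx; split=> //=.
have : (\dim (x + y) < \dim (y + z))%N.
  rewrite ltnNge; apply: contra zN => le.
  by rewrite (subv_dim_eq (sub Hz) le) addvSr.
have := adj_cap y adj; rewrite (capvC z); lia.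
Qed.

Lemma fiberB_hyperplane x y z : z \in calB x y ->
  hyperplane 0%VS x (x :&: z) && ~~ (x :&: y <= x :&: z)%VS.
Proof.
rewrite calBE => /andP[adj /eqP d]; rewrite adj_hyperplane //=.
apply/negP => s; have : (x :&: y <= y :&: z)%VS.
  by rewrite subv_cap capvSr (subv_trans s) ?capvSr.
by move/dimvS; lia.
Qed.

(** * The sums over B_xy and C_xy *)

Variables (E : zmodType) (h : grass V 1 -> E).
Local Notation hat := (hat h).

(** For each hyperplane H of x through x :&: y the members of the fiber form the
    pencil from H to H + y, of size [j + 1]. *)
Lemma sumCE x y j : \dim (x :&: y)%VS = (k - j.+1)%N -> (j < k)%N ->
  sumC h x y = hat (x + y)%VS *+ gnum Q j + hat y *+ Q ^ j
    + (hat x *+ gnum Q j + hat (x :&: y)%VS *+ Q ^ j) *+ (Q * gnum Q j).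
Proof.
move=> dxy jk.
have dxy' := dimv_sum_cap x y; rewrite !dim_grass in dxy'.
rewrite /sumC (partition_big (fun z : grass V k => (x :&: z)%VS)
  (hyperplane (x :&: y) x)) /=; last exact: fiberC_hyperplane.
transitivity (\sum_(H | hyperplane (x :&: y) x H)
    (hat (H + y)%VS + hat H *+ (Q * gnum Q j))).
  apply: eq_bigr => H hH; rewrite (eq_bigl _ _ (fun z => fiberC z hH)).
  have [UH Hx] := and3P hH; rewrite dim_grass => /eqP dH.
  have dHy := dimv_sum_cap H y; rewrite (hyperplane_cap hH) dim_grass in dHy.
  rewrite sum_pencil ?addvSl //; last by lia.
  by congr (_ + _ *+ (_ * gnum _ _)); lia.
rewrite big_split /= sumrMnl.
rewrite (@sum_hyperplane _ _ _ _ _ _ j) ?capvSl //; last first.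
  by rewrite dim_grass; lia.
by rewrite (@sum_hyperplane_add _ _ _ _ _ _ j) // dim_grass; lia.
Qed.

(** For each hyperplane H of x not containing x :&: y, the fiber is the pencil
    from H to the whole space minus the one from H to x + y, so it contributes
    a multiple of hat H and the opposite of hat (x + y).  The sum over these H
    is the sum over all hyperplanes of x minus the one over those through
    x :&: y. *)
Lemma sumBE x y j :
    \dim (x :&: y)%VS = (k - j.+1)%N -> (j < k)%N -> hat fullv = 0 ->
  sumB h x y =
     (hat x *+ (Q ^ j * gnum Q (k - j.+1)) - hat (x :&: y)%VS *+ Q ^ j)
       *+ (Q ^ j.+2 * gnum Q (\dim {:V} - (k + j.+1)))
   - hat (x + y)%VS *+ (Q ^ j.+1 * gnum Q (k - j.+1)).
Proof.
move=> dxy jk h0; set n := \dim {:V}.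
have dxy' := dimv_sum_cap x y; rewrite !dim_grass in dxy'.
have nxy : (\dim (x + y) <= n)%N by rewrite dimvS ?subvf.
set N := (Q ^ j.+2 * gnum Q (n - (k + j.+1)))%N.
rewrite /sumB (partition_big (fun z : grass V k => (x :&: z)%VS)
  (fun H => hyperplane 0%VS x H && ~~ (x :&: y <= H)%VS)) /=; last first.
  exact: fiberB_hyperplane.
transitivity (\sum_(H | hyperplane 0%VS x H && ~~ (x :&: y <= H)%VS)
    (hat H *+ N - hat (x + y)%VS)).
  apply: eq_bigr => H /andP[hH UH].
  rewrite (eq_bigl _ _ (fun z => fiberB z hH UH)).
  have [_ Hx] := and3P hH; rewrite dim_grass => /eqP dH.
  have Hxy : (H <= x + y)%VS by rewrite (subv_trans Hx) ?addvSl.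
  have : \sum_(z : grass V k | (H <= z)%VS) hat z =
      hat H *+ (Q * gnum Q (n - k)).
    rewrite -[RHS]add0r -[X in X + _]h0 -(sum_pencil h dH (subvf H)).
      by apply: eq_bigl => z; rewrite subvf andbT.
    by lia.
  rewrite (bigID (fun z : grass V k => z <= x + y)%VS) /= sum_pencil //; last by lia.
  move/(canRL (addKr _)) => ->; rewrite opprD addrC addrA addrAC.
  congr (_ - _); rewrite -mulrnBr; last first.
    rewrite leq_mul2l; apply/orP; right.
    have -> : (n - k = (\dim (x + y) - k) + (n - \dim (x + y)))%N by lia.
    by rewrite gnumD leq_addr.
  congr (_ *+ _); rewrite -mulnBr -/n.
  have -> : (n - k = j.+1 + (n - (k + j.+1)))%N by lia.
  have -> : (\dim (x + y) - k = j.+1)%N by lia.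
  by rewrite gnumD addKn /N mulnA -expnS.
have part (G : {vspace V} -> E) :
    \sum_(H | hyperplane 0%VS x H && ~~ (x :&: y <= H)%VS) G H
    = \sum_(H | hyperplane 0%VS x H) G H
      - \sum_(H | hyperplane (x :&: y)%VS x H) G H.
  rewrite [X in _ = X - _](bigID (fun H => x :&: y <= H)%VS) /= addrAC.
  rewrite [X in _ = X - _ + _](eq_bigl (hyperplane (x :&: y)%VS x)) ?subrr ?add0r //.
  by move=> H; rewrite /hyperplane sub0v /= andbC.
rewrite part !sumrB !sumrMnl !sum_hyperplane_const ?sub0v ?capvSl //.
rewrite (@sum_hyperplane _ _ _ _ _ _ k.-1) ?sub0v ?dimv0 ?dim_grass //; last by lia.
rewrite (@sum_hyperplane _ _ _ _ _ _ j) ?capvSl ?dim_grass //; last by lia.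
rewrite hat0 mul0rn addr0 ?dimv0 subn0 ?dim_grass dxy.
have -> : (k - (k - j.+1) = j.+1)%N by lia.
have gk : gnum Q k = (gnum Q j.+1 + Q ^ j.+1 * gnum Q (k - j.+1))%N.
  by rewrite -gnumD subnKC.
have lek : (k.-1 = j + (k - j.+1))%N by lia.
rewrite opprD addrACA -opprD -mulrnBl; congr (_ *+ _ - _).
  by rewrite opprD addrA -mulrnBr lek gnumD ?leq_addr // addKn.
by rewrite gk mulrnDr addrC addKr.
Qed.
End Grassmann.

(** * Solving for the intersection and the sum *)

Lemma collect_coefs (R : comNzRingType) (E : lmodType R) (X Y P M B C : E)
    (a b c d b1 b2 b3 c1 c2 c3 c4 : R) :
    B = b1 *: X + b2 *: P + b3 *: M ->
    C = c1 *: X + c2 *: Y + c3 *: P + c4 *: M ->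
  a *: X + b *: Y + c *: B + d *: C =
    (a + c * b1 + d * c1) *: X + (b + d * c2) *: Y
      + (c * b2 + d * c3) *: P + (c * b3 + d * c4) *: M.
Proof.
move=> -> ->; rewrite !scalerDr !scalerDl !scalerA !addrA.
by rewrite [LHS](ACl (1*3*6*2*7*4*8*5*9))/=.
Qed.

Lemma gnum_ratio (R : fieldType) Q m : Q%:R != 1 :> R ->
  (gnum Q m)%:R = (Q%:R ^+ m - 1) / (Q%:R - 1) :> R.
Proof.
rewrite -subr_eq0 => q1; apply: (mulfI q1); rewrite [RHS]mulrC divfK //.
rewrite /gnum natr_sum subrX1; congr (_ * _).
by apply: eq_bigr => j _; rewrite natrX.
Qed.

Theorem theorem11p4 (R : realType) (F : finFieldType) (V : vectType F)
    (n k : nat) (dimV : \dim {:V} = n)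
    (k_ge3 : (6 <= 2 * k)%N) (n_gt2k : (2 * k < n)%N)
    (q : R) (qE : q = #|F|%:R)
    (E : vectType R) (ip : {dot E for idfun}) (h : grass V 1 -> E)
    (dimE : (\dim {:E})%:R = qnum q n - 1)
    (spanE : <<[seq h s | s : grass V 1]>>%VS = {:E}%VS)
    (normE : forall s : grass V 1, ip (h s) (h s) = qnum q n - 1)
    (ipE : forall s t : grass V 1, s != t -> ip (h s) (h t) = -1)
    (sumE : \sum_(s : grass V 1) h s = 0)
    (x y : grass V k) (i : nat) (iE : grass_dist x y = i)
    (i_gt1 : (1 < i)%N) (i_ltk : (i < k)%N) :
  hat h (x :&: y)%VS =
      (qnum q (k%:Z - i%:Z) * qnum q (n%:Z - k%:Z - 1)
        / (q ^ (k%:Z - 1) * qnum q (n%:Z - 2 * k%:Z))) *: hat h x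
    + (qnum q (k%:Z - i%:Z)
        / (q ^ (k%:Z - i%:Z + 1) * qnum q (i%:Z - 1)
             * qnum q (n%:Z - 2 * k%:Z))) *: hat h y
    + (-1 / (q ^ (k%:Z + i%:Z) * qnum q (n%:Z - 2 * k%:Z))) *: sumB h x y
    + (- qnum q (k%:Z - i%:Z)
        / (q ^ k%:Z * qnum q (i%:Z - 1) * qnum q (n%:Z - 2 * k%:Z)))
        *: sumC h x y
  /\
  hat h (x + y)%VS =
      (- qnum q (k%:Z - 1) * qnum q (n%:Z - k%:Z - i%:Z)
        / (q ^ (k%:Z - i%:Z - 1) * qnum q (n%:Z - 2 * k%:Z))) *: hat h x
    + (- qnum q (n%:Z - k%:Z - i%:Z)
        / (q ^ (k%:Z - 2 * i%:Z + 1) * qnum q (i%:Z - 1)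
             * qnum q (n%:Z - 2 * k%:Z))) *: hat h y
    + (1 / (q ^ k%:Z * qnum q (n%:Z - 2 * k%:Z))) *: sumB h x y
    + (qnum q (n%:Z - k%:Z - i%:Z)
        / (q ^ (k%:Z - i%:Z) * qnum q (i%:Z - 1)
             * qnum q (n%:Z - 2 * k%:Z))) *: sumC h x y.
Proof.
have hV : hat h fullv = 0.
  by rewrite -sumE /hat; apply: eq_bigl => s; rewrite subvf.
(* With i = j + 1, k = i + a and n = 2k + b, every Gaussian integer in the
   statement becomes a rational function of q and the powers u = q^j, v = q^a,
   w = q^b. *)
have [j ij] : exists j, i = j.+1 by exists i.-1; lia.
have [a ka] : exists a, k = (j.+1 + a)%N by exists (k - i)%N; lia.
have [b nb] : exists b, n = (2 * k + b)%N by exists (n - 2 * k)%N; lia.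
have dxy : \dim (x :&: y)%VS = (k - j.+1)%N.
  by have := cap_le x y; move: iE; rewrite grass_distE; lia.
have jk : (j < k)%N by lia.
have eB := sumBE dxy jk hV; have eC := sumCE h dxy jk.
move: eB eC; rewrite dimV.
have -> : (k - j.+1 = a)%N by lia.
have -> : (n - (k + j.+1) = a + b)%N by lia.
have q1 : 1 < q by rewrite qE ltr1n finNzRing_gt1.
rewrite -!scaler_nat !natrM !gnum_ratio -?qE ?gt_eqF // !natrX -qE => eB eC.
set P := hat h (x :&: y)%VS in eB eC *; set M := hat h (x + y)%VS in eB eC *.
set X := hat h x in eB eC *; set Y := hat h y in eB eC *.
have q0 : q != 0 by rewrite gt_eqF // (lt_trans ltr01).
have q10 : q - 1 != 0 by rewrite subr_eq0 gt_eqF.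
have pow1 m : (0 < m)%N -> q ^+ m - 1 != 0.
  by case: m => // m _; rewrite subr_eq0 gt_eqF // exprn_egt1.
have pow0 m : q ^+ m != 0 by rewrite expf_neq0.
have {}eB : sumB h x y =
   (q ^+ j * ((q ^+ a - 1) / (q - 1))
      * (q ^+ j.+2 * ((q ^+ (a + b) - 1) / (q - 1)))) *: X
 + (- (q ^+ j * (q ^+ j.+2 * ((q ^+ (a + b) - 1) / (q - 1))))) *: P
 + (- (q ^+ j.+1 * ((q ^+ a - 1) / (q - 1)))) *: M.
  rewrite eB scalerBr !scalerA !scaleNr.
  by congr (_ *: _ - _ *: _ - _); rewrite !exprS; ring.
have {}eC : sumC h x y =
   (((q ^+ j - 1) / (q - 1)) * (q * ((q ^+ j - 1) / (q - 1)))) *: X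
 + (q ^+ j) *: Y
 + (q ^+ j * (q * ((q ^+ j - 1) / (q - 1)))) *: P
 + ((q ^+ j - 1) / (q - 1)) *: M.
  rewrite eC scalerDr !scalerA addrC [RHS](ACl (1*3*(4*2)))/=.
  by congr (_ *: _ + _ *: _ + _); ring.
have qn (m : int) (p : nat) : m = p%:Z -> q ^ m = q ^+ p by move=> ->.
have qj : (0 < j)%N by lia.
have qb : (0 < b)%N by lia.
have J0 := pow1 j qj; have B0 := pow1 b qb.
have j0 := pow0 j; have a0 := pow0 a; have b0 := pow0 b.
have e1 : q ^ (k%:Z - i%:Z) = q ^+ a by apply: qn; lia.
have e2 : q ^ (n%:Z - k%:Z - 1) = q ^+ j * q ^+ a * q ^+ b.
  by rewrite -!exprD; apply: qn; lia.
have e3 : q ^ (k%:Z - 1) = q ^+ j * q ^+ a.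
  by rewrite -!exprD; apply: qn; lia.
have e4 : q ^ (n%:Z - 2 * k%:Z) = q ^+ b by apply: qn; lia.
have e5 : q ^ (k%:Z - i%:Z + 1) = q * q ^+ a.
  by rewrite -!exprS; apply: qn; lia.
have e6 : q ^ (i%:Z - 1) = q ^+ j by apply: qn; lia.
have e7 : q ^ (k%:Z + i%:Z) = q ^+ 2 * q ^+ j * q ^+ j * q ^+ a.
  by rewrite -!exprD; apply: qn; lia.
have e8 : q ^ k%:Z = q * q ^+ j * q ^+ a.
  by rewrite -exprS -!exprD; apply: qn; lia.
have e9 : q ^ (n%:Z - k%:Z - i%:Z) = q ^+ a * q ^+ b.
  by rewrite -!exprD; apply: qn; lia.
have e10 : q ^ (k%:Z - i%:Z - 1) = q ^+ a / q.
  by rewrite expfzDr // e1 exprN1.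
have e11 : q ^ (k%:Z - 2 * i%:Z + 1) = q ^+ a / q ^+ j.
  have -> : k%:Z - 2 * i%:Z + 1 = a%:Z - j%:Z by lia.
  by rewrite expfzDr // -exprnN.
split; rewrite (collect_coefs _ _ _ _ eB eC) /qnum
    ?(e1, e2, e3, e4, e5, e6, e7, e8, e9, e10, e11) ?exprS ?exprD;
  move: (q ^+ j) (q ^+ a) (q ^+ b) J0 B0 j0 a0 b0 => u v w u1 w1 u0 v0 w0.
- transitivity (0 *: X + 0 *: Y + 1 *: P + 0 *: M).
    by rewrite !scale0r scale1r !add0r addr0.
  by congr (_ *: _ + _ *: _ + _ *: _ + _ *: _);
    field; rewrite ?q0 ?q10 ?u1 ?w1 ?u0 ?v0.
- transitivity (0 *: X + 0 *: Y + 0 *: P + 1 *: M).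
    by rewrite !scale0r scale1r !add0r.
  by congr (_ *: _ + _ *: _ + _ *: _ + _ *: _);
    field; rewrite ?q0 ?q10 ?u1 ?w1 ?u0 ?v0.
Qed.
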